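(* Let $(X,E)$ be a finite weighted graph with weights $\mu,g$, let $q:X\to\mathbb{R}$ be a potential and let $B\subset X$. Assume that there does not exist a nonzero eigenfunction of the Schrödinger operator $-\Delta_X+q$ vanishing identically on $B$. Then the following statements hold. (1) Let $(\lambda_j,\phi_j|_B)_{j=1}^{|X|}$ be the interior spectral data. For $w:X\to\mathbb{R}$ let $U_w:X\times\mathbb{N}\to\mathbb{R}$ be the solution of $$D_tU_w(x,t)-\Delta_XU_w(x,t)+q(x)U_w(x,t)=0,\ (x,t)\in X\times\mathbb{N},\qquad U_w(x,0)=w(x),\ x\in X.$$ Then, given the interior spectral data, the measurement $U_w|_{B\times\mathbb{N}}$ determines $\langle w,\phi_j\rangle_{L^2(X)}$ for all $j=1,\dots,|X|$. Precisely: let $(X',E',\mu',g',q')$ be another finite weighted graph with potential and $B'\subset X'$ such that no nonzero eigenfunction of $-\Delta_{X'}+q'$ vanishes identically on $B'$. Suppose $|X'|=|X|$, let $\Phi_0:B\to B'$ be a bijection, and let $\{\phi'_j\}$ be a complete orthonormal family of eigenfunctions of $-\Delta_{X'}+q'$ with eigenvalues $\lambda'_j=\lambda_j$ and $\phi'_j\circ\Phi_0=\phi_j|_B$ for all $j$. If $w:X\to\mathbb{R}$ and $w':X'\to\mathbb{R}$ satisfy $U_w(z,t)=U'_{w'}(\Phi_0(z),t)$ for all $z\in B$, $t\in\mathbb{N}$ (where $U'_{w'}$ is the corresponding solution on $X'$), then $\langle w,\phi_j\rangle_{L^2(X)}=\langle w',\phi'_j\rangle_{L^2(X')}$ for all $j$.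 (2) For any $T\in\mathbb{Z}_+$ with $T\ge|X|$, $$\{U^f(\cdot,T):\ \operatorname{supp}(f)\subset B\times\{0,1,\dots,T-1\}\}=L^2(X),$$ where, for a real-valued source $f$ with this support, $U^f:X\times\{0,1,\dots,T\}\to\mathbb{R}$ is the solution of $D_tU^f(x,t)-\Delta_XU^f(x,t)+q(x)U^f(x,t)=f(x,t)$ for $x\in X$, $t\in\{0,1,\dots,T-1\}$, with $U^f(x,0)=0$ for $x\in X$.
   Context: Graphs are finite, undirected and simple; $x\sim y$ means $\{x,y\}\in E$; $\mathbb{N}=\{0,1,2,\dots\}$, $\mathbb{Z}_+=\{1,2,\dots\}$. A weighted graph carries a measure $\mu_x>0$ on each vertex and a symmetric weight $g_{xy}=g_{yx}>0$ on each edge. The graph Laplacian is $(\Delta_X u)(x)=\frac{1}{\mu_x}\sum_{y\sim x}g_{xy}(u(y)-u(x))$, $x\in X$. $L^2(X)$ is the space of all real-valued functions on $X$ with inner product $\langle u_1,u_2\rangle_{L^2(X)}=\sum_{x\in X}\mu_x u_1(x)u_2(x)$. The discrete time derivative is $D_tu(x,t)=u(x,t+1)-u(x,t)$. An eigenfunction of $-\Delta_X+q$ is a function $\phi:X\to\mathbb{R}$ with $-\Delta_X\phi+q\phi=\lambda\phi$ on all of $X$ for some $\lambda\in\mathbb{R}$. Interior spectral data on $B$: $(\lambda_j,\phi_j|_B)_{j=1}^{|X|}$, where $\{\phi_j\}_{j=1}^{|X|}$ is a complete $L^2(X)$-orthonormal family of eigenfunctions of $-\Delta_X+q$ with eigenvalues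 $\lambda_j$. *)

(* Defs.v *)
From HB Require Import structures.
From mathcomp Require Import all_boot all_order all_algebra.
From mathcomp Require Import boolp classical_sets reals ring.

Set Implicit Arguments.
Unset Strict Implicit.
Unset Printing Implicit Defensive.

Import Order.TTheory GRing.Theory Num.Theory.
Local Open Scope ring_scope.

(* Only the values [weight G x y] with [adj G x y] are ever used; the others
   are unconstrained. *)
Record weighted_graph (R : realType) (X : finType) := WeightedGraph {
  adj : rel X;
  adj_sym : symmetric adj;
  adj_irr : irreflexive adj;
  measure : X -> R;
  measure_gt0 : forall x, 0 < measure x;
  weight : X -> X -> R;
  weight_sym : forall x y, adj x y -> weight x y = weight y x;
  weight_gt0 : forall x y, adj x y -> 0 < weight x y
}.

Section Operators.
Variables (R : realType) (X : finType) (G : weighted_graph R X).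
Implicit Types (u phi q w : X -> R) (U f : X -> nat -> R).

Definition laplacian u (x : X) : R :=
  (measure G x)^-1 * \sum_(y | adj G x y) weight G x y * (u y - u x).

Definition schrodinger q u (x : X) : R := - laplacian u x + q x * u x.

Definition inner u1 u2 : R := \sum_x measure G x * u1 x * u2 x.

Definition eigenfunction_for q (lambda : R) phi : Prop :=
  forall x, schrodinger q phi x = lambda * phi x.

Definition eigenfunction q phi : Prop :=
  exists lambda : R, eigenfunction_for q lambda phi.

Definition no_eigenfunction_vanishing_on q (B : {set X}) : Prop :=
  ~ exists phi, [/\ eigenfunction q phi, (exists x, phi x != 0)
                  & forall x, x \in B -> phi x = 0].

Definition complete_orthonormal (n : nat) (phi : 'I_n -> X -> R) : Prop :=
  (forall i j, inner (phi i) (phi j) = (i == j)%:R) /\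
  (forall u, exists c : 'I_n -> R, forall x, u x = \sum_j c j * phi j x).

Definition spectral_family q (n : nat) (lambda : 'I_n -> R)
    (phi : 'I_n -> X -> R) : Prop :=
  complete_orthonormal phi /\
  (forall j, eigenfunction_for q (lambda j) (phi j)).

Definition time_diff U (x : X) (t : nat) : R := U x t.+1 - U x t.

Definition heat_operator q U (x : X) (t : nat) : R :=
  time_diff U x t - laplacian (U^~ t) x + q x * U x t.

Definition heat_solution q w U : Prop :=
  (forall x t, heat_operator q U x t = 0) /\ (forall x, U x 0%N = w x).

(* Functions on X x {0, ..., T} and X x {0, ..., T - 1} are represented by
   functions on X x nat; the values of U at times t > T are unconstrained. *)
Definition source_solution q (T : nat) f U : Prop :=
  (forall x t, (t < T)%N -> heat_operator q U x t = f x t) /\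
  (forall x, U x 0%N = 0).

Definition supported_in (B : {set X}) (T : nat) f : Prop :=
  forall x t, f x t != 0 -> x \in B /\ (t < T)%N.

Definition reachable_set q (B : {set X}) (T : nat) : set (X -> R) :=
  [set v | exists f U,
    [/\ supported_in B T f, source_solution q T f U & U^~ T = v]]%classic.

(* Both initial value problems are uniquely solvable, so that quantifying over
   solutions amounts to speaking of the solution. *)
Fixpoint heat_flow q f w (t : nat) : X -> R :=
  if t is s.+1 then
    fun x => heat_flow q f w s x - schrodinger q (heat_flow q f w s) x + f x s
  else w.

Lemma heat_operator_flow q f w x t :
  heat_operator q (fun y s => heat_flow q f w s y) x t = f x t.
Proof.
rewrite /heat_operator /time_diff /= /schrodinger.
set L := laplacian _ x; set a := heat_flow _ _ _ t x.
by ring.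
Qed.

Lemma heat_flow_unique q f w (T : nat) U :
  (forall x t, (t < T)%N -> heat_operator q U x t = f x t) ->
  (forall x, U x 0%N = w x) ->
  forall t, (t <= T)%N -> U^~ t = heat_flow q f w t.
Proof.
move=> hU h0; elim=> [|t IH] tT; first exact/funext.
apply/funext => x /=; rewrite -(IH (ltnW tT)) -(hU x t tT).
by rewrite /heat_operator /time_diff /schrodinger; ring.
Qed.

Lemma heat_solution_ex q w : exists U, heat_solution q w U.
Proof.
exists (fun x t => heat_flow q (fun _ _ => 0) w t x); split => // x t.
exact: heat_operator_flow.
Qed.

Lemma heat_solution_unique q w U1 U2 :
  heat_solution q w U1 -> heat_solution q w U2 -> forall x t, U1 x t = U2 x t.
Proof.
move=> [h1 i1] [h2 i2] x t.
have e U : (forall x t, heat_operator q U x t = 0) ->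
    (forall x, U x 0%N = w x) -> U^~ t = heat_flow q (fun _ _ => 0) w t.
  by move=> h i; apply: (@heat_flow_unique _ _ _ t).
exact: (congr1 (@^~ x) (etrans (e _ h1 i1) (esym (e _ h2 i2)))).
Qed.

Lemma source_solution_ex q T f : exists U, source_solution q T f U.
Proof.
exists (fun x t => heat_flow q f (fun=> 0) t x); split => // x t _.
exact: heat_operator_flow.
Qed.

Lemma source_solution_unique q T f U1 U2 :
  source_solution q T f U1 -> source_solution q T f U2 ->
  forall x t, (t <= T)%N -> U1 x t = U2 x t.
Proof.
move=> [h1 i1] [h2 i2] x t tT.
have e1 := heat_flow_unique h1 i1 tT; have e2 := heat_flow_unique h2 i2 tT.
exact: (congr1 (@^~ x) (etrans e1 (esym e2))).
Qed.

End Operators.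

(* Main.v *)
Require Import Defs.
From HB Require Import structures.
From mathcomp Require Import all_boot all_order all_algebra.
From mathcomp Require Import boolp classical_sets reals.
From mathcomp Require Import complex ring.

Import Order.TTheory GRing.Theory Num.Theory.
Local Open Scope ring_scope.

(** Write [H] for the Schrodinger operator. One time step of the heat equation
    applies [I - H] and then adds the source, and [H] is self-adjoint for the
    weighted inner product because summation by parts on the edges is symmetric
    in the two functions.

    Part (1). Expanding [w] in the orthonormal eigenfunctions gives
    [U(t) = \sum_j <w, phi_j> (1 - lambda_j)^t phi_j]. If two such solutions
    agree on [B], their coefficient differences [c_j] satisfy
    [\sum_j c_j (1 - lambda_j)^t phi_j = 0] on [B] for all [t], hence
    [\sum_j c_j p(1 - lambda_j) phi_j = 0] on [B] for every polynomial [p].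
    Choosing [p] to vanish at [1 - lambda] for all eigenvalues [lambda] other
    than [lambda_i] leaves an eigenfunction vanishing on [B]; it must be zero,
    and pairing it with [phi_i] gives [c_i = 0] ([exp_sums_separate]).

    Part (2). The states reachable in [t] steps form an increasing chain of
    subspaces with [K_{t+1} = (I - H) K_t + L(B)], [L(B)] being the functions
    supported on [B]. Such a chain stops growing forever once two consecutive
    terms agree, so by counting dimensions it is stable under [I - H] from step
    [|X|] on ([stable_reach_space]). If [K_{|X|}] were a proper subspace, its
    orthogonal complement would be nonzero, stable under the self-adjoint
    operator [I - H], and made of functions vanishing on [B]. A self-adjoint
    operator has an eigenvector in every nonzero stable subspace
    ([selfadjoint_stable_eigenvector]), so an eigenfunction would vanish on [B]
    ([reach_space_full]). *)

(** * Eigenvectors of self-adjoint matrices *)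

(** The pair is the real and imaginary part of an eigenvector of [M] over the
    complex numbers, for the eigenvalue [a + i b]; it serves to find real
    eigenvectors without extending the scalars of the ambient space. *)
Lemma real_matrix_invariant_pair {R : rcfType} {r} (M : 'M[R]_r) : (0 < r)%N ->
  exists (a b : R) (u1 u2 : 'rV[R]_r),
    [/\ (u1 != 0) || (u2 != 0),
        u1 *m M = a *: u1 - b *: u2 & u2 *m M = b *: u1 + a *: u2].
Proof.
move=> r_gt0; pose MC := map_mx (real_complex R) M.
(* The characteristic polynomial is not constant, hence has a complex root. *)
have /closed_rootP [z] : size (char_poly MC) != 1%N.
  by rewrite size_char_poly eqSS -lt0n.
rewrite -eigenvalue_root_char => /eigenvalueP [u uM u_neq0].
pose u1 := map_mx (@complex.Re R) u; pose u2 := map_mx (@complex.Im R) u.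
have uMj j :
    ((\sum_k u1 0 k * M k j) +i* (\sum_k u2 0 k * M k j))%C = z * u 0 j.
  have := congr1 (fun v : 'rV_r => v 0 j) uM; rewrite /= mxE [in RHS]mxE => <-.
  apply: (big_rec3 (fun x y w => (x +i* y)%C = w)) => // k x y w _ <-.
  by rewrite !mxE; case: (u 0 k) => p r'; simpc.
exists (complex.Re z), (complex.Im z), u1, u2; split.
- apply: contra_neqT u_neq0; rewrite negb_or !negbK => /andP [/eqP h1 /eqP h2].
  apply/rowP => j; have := congr1 (fun v : 'rV_r => v 0 j) h1.
  have := congr1 (fun v : 'rV_r => v 0 j) h2.
  by rewrite !mxE /=; case: (u 0 j) => x y /= -> ->.
- apply/rowP => j; rewrite !mxE; have := congr1 (@complex.Re R) (uMj j).
  by rewrite /= => ->; case: z {uM uMj} (u 0 j) => a b [x y].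
- apply/rowP => j; rewrite !mxE; have := congr1 (@complex.Im R) (uMj j).
  by rewrite /= => ->; case: z {uM uMj} (u 0 j) => a b [x y] /=; ring.
Qed.

(** Only the restriction of [A] to [W], a square matrix in a basis of [W], has
    to be complexified. *)
Lemma stable_invariant_pair {R : rcfType} {m n} (A : 'M[R]_n)
    (W : 'M[R]_(m, n)) : stablemx W A -> W != 0 ->
  exists (a b : R) (v1 v2 : 'rV_n),
    [/\ (v1 <= W)%MS /\ (v2 <= W)%MS, (v1 != 0) || (v2 != 0),
        v1 *m A = a *: v1 - b *: v2 & v2 *m A = b *: v1 + a *: v2].
Proof.
move=> stW W_neq0.
have /submxP [M WAM] : (row_base W *m A <= row_base W)%MS.
  by rewrite -[(_ <= _)%MS]/(stablemx _ _) stablemx_row_base.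
have rW : (0 < \rank W)%N by rewrite lt0n mxrank_eq0.
have [a [b [u1 [u2 [u_neq0 u1M u2M]]]]] := real_matrix_invariant_pair M rW.
exists a, b, (u1 *m row_base W), (u2 *m row_base W); split.
- by split; rewrite -(eq_row_base W) submxMl.
- by rewrite !mulmx_free_eq0 ?row_base_free.
- by rewrite -mulmxA WAM mulmxA u1M mulmxBl -!scalemxAl.
- by rewrite -mulmxA WAM mulmxA u2M mulmxDl -!scalemxAl.
Qed.

(** Write [<u, v>] for the positive definite form [u D v^T]; [A] is self-adjoint
    for it. Take an invariant pair [v1], [v2] in [W] for [a + i b]. Comparing
    [<v1 A, v2>] with [<v1, v2 A>] gives [b (|v1|^2 + |v2|^2) = 0], so [b = 0] and whichever of
    the two vectors is nonzero is an eigenvector. *)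
Lemma selfadjoint_stable_eigenvector {R : rcfType} {m n} (A D : 'M[R]_n)
    (W : 'M[R]_(m, n)) :
  (forall u : 'rV_n, u != 0 -> 0 < (u *m D *m u^T) 0 0) ->
  A *m D = D *m A^T -> stablemx W A -> W != 0 ->
  exists (a : R) (v : 'rV_n), [/\ v != 0, (v <= W)%MS & v *m A = a *: v].
Proof.
move=> Dpos AD stW W_neq0.
have [a [b [v1 [v2 [[v1W v2W] v_neq0 v1A v2A]]]]] :=
  stable_invariant_pair _ _ stW W_neq0.
pose N (v : 'rV_n) : R := (v *m D *m v^T) 0 0.
have Nge0 v : 0 <= N v.
  by have [->|/Dpos/ltW] := eqVneq v 0; rewrite // /N !mul0mx mxE.
have Neq0 v : (N v == 0) = (v == 0).
  apply/eqP/eqP => [|->]; last by rewrite /N !mul0mx mxE.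
  move=> Nv0; apply/eqP; apply: contraTT isT => /Dpos.
  by rewrite -/(N v) Nv0 ltxx.
have bN : b * (N v1 + N v2) = 0.
  have : v1 *m A *m D *m v2^T = v1 *m D *m (v2 *m A)^T.
    by rewrite trmx_mul !mulmxA -(mulmxA v1 A) AD mulmxA.
  rewrite v1A v2A mulmxBl linearD !linearZ /= mulmxBl mulmxDr.
  rewrite -!scalemxAl -!scalemxAr => /(congr1 (fun S : 'M_1 => S 0 0)).
  rewrite mxE [in RHS]mxE [in X in _ + X = _]mxE.
  rewrite [X in X - _ = _]mxE [X in _ - X = _]mxE [X in _ = X + _]mxE.
  rewrite [X in _ = _ + X]mxE -/(N v1) -/(N v2).
  set p : R := (v1 *m D *m v2^T) 0 0 => e.
  by apply: (addIr (a * p - b * N v2)); rewrite [in RHS]e; ring.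
have b0 : b = 0.
  move/eqP: bN; rewrite mulf_eq0 paddr_eq0 // !Neq0 orbC.
  by rewrite -implyNb negb_and v_neq0 => /eqP.
case/orP: v_neq0 => v_neq0; [exists a, v1 | exists a, v2]; split=> //.
  by rewrite v1A b0 scale0r subr0.
by rewrite v2A b0 scale0r add0r.
Qed.

(** * Reachable subspaces of a linear control system *)

Section Controllability.
Context {F : fieldType} {n : nat} (A P : 'M[F]_n).

(** States reachable at time [t] by [x_{s+1} = x_s A + b_s P], [x_0 = 0]. This
    recursion, rather than the sum of the images of [P A^k], follows the time
    stepping, so that controls can be read off from membership. *)
Fixpoint reach_space (t : nat) : 'M[F]_n :=
  if t is s.+1 then (reach_space s *m A + P)%MS else 0.

Lemma reach_spaceS t : (reach_space t <= reach_space t.+1)%MS.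
Proof.
elim: t => [|t IH]; first exact: sub0mx.
by rewrite [X in (_ <= X)%MS]/=; apply: addsmxS => //; apply: submxMr.
Qed.

Lemma reach_space_mono s t :
  (s <= t)%N -> (reach_space s <= reach_space t)%MS.
Proof.
move/subnKC <-; elim: (t - s)%N => [|k IH]; first by rewrite addn0.
by rewrite addnS; apply: submx_trans IH (reach_spaceS _).
Qed.

(** Each step either gains a dimension or stalls, and a stalled chain stalls
    at all later steps. *)
Lemma reach_space_stall t :
  (t <= \rank (reach_space t))%N || (reach_space t.+1 <= reach_space t)%MS.
Proof.
elim: t => [//|t IH].
have [stall|grow] := boolP (reach_space t.+1 <= reach_space t)%MS.
  by apply/orP; right; apply: addsmxS => //; apply: submxMr.
move: IH; rewrite (negPf grow) orbF => rk; apply/orP; left.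
by apply: leq_ltn_trans rk _; apply: rank_ltmx; rewrite /ltmx reach_spaceS.
Qed.

(** At step [n] the chain has stalled, since otherwise it already fills the
    space. *)
Lemma stable_reach_space : stablemx (reach_space n) A.
Proof.
have stall : (reach_space n.+1 <= reach_space n)%MS.
  case/orP: (reach_space_stall n) => // rk.
  by rewrite submx_full // -col_leq_rank.
by apply: submx_trans stall; apply: addsmxSl.
Qed.

Lemma sub_reach_space t : (0 < t)%N -> (P <= reach_space t)%MS.
Proof. by case: t => // t _; apply: addsmxSr. Qed.

End Controllability.

(** The orthogonal complement [W] of the reachable space [K] for the form
    [u D v^T] is stable under [A], because [K] is and [A] is self-adjoint, and
    it is annihilated by [v |-> v D P^T], because [K] contains the rows of [P].
    If it were nonzero it would contain an eigenvector. *)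
Lemma reach_space_full {R : rcfType} {n} (A P D : 'M[R]_n) :
  (forall u : 'rV_n, u != 0 -> 0 < (u *m D *m u^T) 0 0) ->
  A *m D = D *m A^T ->
  (forall (a : R) (v : 'rV_n),
     v *m A = a *: v -> v *m D *m P^T = 0 -> v = 0) ->
  row_full (reach_space A P n).
Proof.
move=> Dpos AD noeig; set K := reach_space A P n.
rewrite -col_leq_rank leqNgt; apply/negP => rkK.
have /submxP [C KA] : (K *m A <= K)%MS by apply: stable_reach_space.
have /submxP [S PK] : (P <= K)%MS.
  by apply: sub_reach_space; apply: leq_ltn_trans rkK.
pose W := kermx (D *m K^T).
have W_neq0 : W != 0.
  rewrite -mxrank_eq0 mxrank_ker -lt0n subn_gt0.
  by apply: leq_ltn_trans (mxrankM_maxr _ _) _; rewrite mxrank_tr.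
have stW : stablemx W A.
  apply/sub_kermxP; rewrite mulmxA -(mulmxA W) AD -!mulmxA -trmx_mul KA.
  by rewrite trmx_mul !mulmxA -(mulmxA W) mulmx_ker mul0mx.
have [a [v [v_neq0 /sub_kermxP vW vA]]] :=
  selfadjoint_stable_eigenvector _ _ _ Dpos AD stW W_neq0.
case/eqP: v_neq0; apply: noeig vA _.
by rewrite PK trmx_mul !mulmxA -(mulmxA v) vW mul0mx.
Qed.

(** * The heat equation of a Schrodinger operator *)

Section Schrodinger.
Context {R : realType} {X : finType} (G : weighted_graph R X) (q : X -> R).
Implicit Types (u v w : X -> R) (f : X -> nat -> R) (r : 'rV[R]_#|X|).

Lemma schrodinger_sum {I : finType} (c : I -> R) (phi : I -> X -> R) x :
  schrodinger G q (fun y => \sum_i c i * phi i y) x =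
  \sum_i c i * schrodinger G q (phi i) x.
Proof.
rewrite /schrodinger /laplacian.
under [RHS]eq_bigr => i _ do rewrite mulrDr mulrN !mulr_sumr.
rewrite big_split /= sumrN exchange_big /= !mulr_sumr; congr (- _ + _).
  apply: eq_bigr => y _; rewrite -sumrB !mulr_sumr.
  by apply: eq_bigr => i _; ring.
by apply: eq_bigr => i _; ring.
Qed.

(** The measure cancels the factor of the Laplacian. What remains is a diagonal
    form, symmetric in the two functions, minus the sum of
    [weight x y * a y * b x] over oriented edges, which reversing the edges
    turns into the same sum with [a] and [b] exchanged. *)
Lemma inner_schrodinger u v :
  inner G (schrodinger G q u) v = inner G u (schrodinger G q v).
Proof.
have edges (a b : X -> R) : inner G (schrodinger G q a) b =
    \sum_x (\sum_(y | adj G x y) weight G x y * a x * b x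
            + measure G x * q x * a x * b x)
    - \sum_x \sum_(y | adj G x y) weight G x y * a y * b x.
  rewrite -sumrB; apply: eq_bigr => x _.
  rewrite /schrodinger /laplacian mulrDr mulrN.
  rewrite mulVKf ?gt_eqF ?measure_gt0 // mulrDl mulNr mulr_suml -sumrN.
  rewrite addrAC -sumrB mulrA; congr (_ + _).
  by apply: eq_bigr => y _; ring.
have inner_sym a b : inner G a b = inner G b a.
  by apply: eq_bigr => x _; ring.
rewrite [RHS]inner_sym !edges; congr (_ - _).
  apply: eq_bigr => x _; congr (_ + _); last by ring.
  by apply: eq_bigr => y _; ring.
rewrite [LHS](exchange_big_dep xpredT) //=; apply: eq_bigr => x _.
apply: eq_big => [y|y xy]; first exact: adj_sym.
by rewrite (weight_sym xy); ring.
Qed.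

Lemma inner_sum {I : finType} (c : I -> R) (phi : I -> X -> R) v :
  inner G (fun x => \sum_i c i * phi i x) v = \sum_i c i * inner G (phi i) v.
Proof.
under [RHS]eq_bigr => i _ do rewrite mulr_sumr.
rewrite exchange_big; apply: eq_bigr => x _.
by rewrite mulr_sumr mulr_suml; apply: eq_bigr => i _; ring.
Qed.

Definition heat_step u (x : X) : R := u x - schrodinger G q u x.

Lemma inner_heat_step u v :
  inner G (heat_step u) v = inner G u (heat_step v).
Proof.
have split1 a b : inner G (heat_step a) b =
    inner G a b - inner G (schrodinger G q a) b.
  by rewrite -sumrB; apply: eq_bigr => x _; rewrite /heat_step; ring.
rewrite split1 inner_schrodinger -sumrB; apply: eq_bigr => x _.
by rewrite /heat_step; ring.
Qed.

Lemma heat_step_sum {I : finType} (c : I -> R) (phi : I -> X -> R) x :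
  heat_step (fun y => \sum_i c i * phi i y) x =
  \sum_i c i * heat_step (phi i) x.
Proof.
rewrite /heat_step schrodinger_sum -sumrB.
by apply: eq_bigr => i _; rewrite mulrBr.
Qed.

Lemma heat_solution_step w U x t :
  heat_solution G q w U -> U x t.+1 = heat_step (U^~ t) x.
Proof.
move=> [/(_ x t) heatU _]; apply: (addIr (- heat_step (U^~ t) x)).
rewrite subrr -[RHS]heatU /heat_operator /time_diff /heat_step /schrodinger.
by ring.
Qed.

Lemma orthonormal_coord {n} (phi : 'I_n -> X -> R) w :
  complete_orthonormal G phi ->
  w = fun x => \sum_j inner G w (phi j) * phi j x.
Proof.
move=> [ortho span]; have [c wE] := span w.
have {}wE : w = fun x => \sum_j c j * phi j x by apply/funext.
rewrite {1}wE; apply/funext => x; apply: eq_bigr => j _; congr (_ * _).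
rewrite wE inner_sum (bigD1 j) //= ortho eqxx mulr1 big1 ?addr0 // => i ij.
by rewrite ortho (negPf ij) mulr0.
Qed.

Lemma heat_solution_spectral {n} (lambda : 'I_n -> R) phi w U x t :
  spectral_family G q lambda phi -> heat_solution G q w U ->
  U x t = \sum_j inner G w (phi j) * (1 - lambda j) ^+ t * phi j x.
Proof.
move=> [onb eig] solU; elim: t x => [|t IH] x.
  rewrite solU.2 {1}(orthonormal_coord _ w onb).
  by apply: eq_bigr => j _; rewrite expr0 mulr1.
rewrite (heat_solution_step _ _ _ _ solU).
have -> : U^~ t =
    fun x => \sum_j inner G w (phi j) * (1 - lambda j) ^+ t * phi j x.
  exact/funext.
rewrite heat_step_sum; apply: eq_bigr => j _.
by rewrite /heat_step (eig j x) exprSr; ring.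
Qed.

(** Passing from powers of [1 - lambda_j] to polynomials in it isolates one
    eigenspace at a time; inside an eigenspace, a combination vanishing on [B]
    is an eigenfunction or zero, so all its coefficients vanish. *)
Lemma exp_sums_separate {n} (B : {set X}) (lambda c : 'I_n -> R) phi :
  no_eigenfunction_vanishing_on G q B -> spectral_family G q lambda phi ->
  (forall x, x \in B ->
     forall t, \sum_j c j * (1 - lambda j) ^+ t * phi j x = 0) ->
  forall j, c j = 0.
Proof.
move=> noeig [[ortho _] eig] sum0 i.
have poly0 (p : {poly R}) x : x \in B ->
    \sum_j c j * p.[1 - lambda j] * phi j x = 0.
  move=> xB; under eq_bigr => j _ do
    rewrite horner_coef mulr_sumr mulr_suml.
  rewrite exchange_big big1 //= => t _.
  transitivity (p`_t * \sum_j c j * (1 - lambda j) ^+ t * phi j x).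
    by rewrite mulr_sumr; apply: eq_bigr => j _; ring.
  by rewrite sum0 ?mulr0.
pose p : {poly R} := \prod_(j | lambda j != lambda i) ('X - (1 - lambda j)%:P).
have p_other j : lambda j != lambda i -> p.[1 - lambda j] = 0.
  by move=> ji; rewrite horner_prod (bigD1 j) //= hornerXsubC subrr mul0r.
have p_neq0 : p.[1 - lambda i] != 0.
  rewrite horner_prod prodf_seq_neq0; apply/allP => j _; apply/implyP => ji.
  by rewrite hornerXsubC opprB addrC addrA subrK subr_eq0.
pose psi x := \sum_j (c j * p.[1 - lambda j]) * phi j x.
have psi0 x : psi x = 0.
  apply: contrapT => /eqP psix; apply: noeig; exists psi.
  split; [exists (lambda i) | by exists x | by move=> y; apply: poly0].
  move=> y; rewrite schrodinger_sum mulr_sumr; apply: eq_bigr => j _.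
  rewrite (eig j y); have [->|ji] := eqVneq (lambda j) (lambda i).
    by ring.
  by rewrite p_other //; ring.
have: inner G psi (phi i) = 0.
  by apply: big1 => x _; rewrite psi0 mulr0 mul0r.
rewrite inner_sum (bigD1 i) //= ortho eqxx mulr1 big1 => [|j ji]; last first.
  by rewrite ortho (negPf ji) mulr0.
by rewrite addr0 => /eqP; rewrite mulf_eq0 (negPf p_neq0) orbF => /eqP.
Qed.

(** * Reachability for the heat equation *)

(** Functions become rows, on which the time step [I - H], the inner product
    and the restriction to [B] act as matrices from the right, so that subspaces
    of functions are row spaces. *)
Definition row_of u : 'rV[R]_#|X| := \row_i u (enum_val i).
Definition fun_of (r : 'rV[R]_#|X|) (x : X) : R := r 0 (enum_rank x).
Definition vertex_fun (i : 'I_#|X|) (x : X) : R := (x == enum_val i)%:R.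

Definition heat_mx : 'M[R]_#|X| :=
  \matrix_(i, j) heat_step (vertex_fun i) (enum_val j).
Definition measure_mx : 'M[R]_#|X| :=
  diag_mx (\row_i measure G (enum_val i)).
Definition control_mx (B : {set X}) : 'M[R]_#|X| :=
  diag_mx (\row_i (enum_val i \in B)%:R).

Lemma row_ofK : cancel row_of fun_of.
Proof. by move=> u; apply/funext => x; rewrite /fun_of mxE enum_rankK. Qed.

Lemma fun_of_heat_mx r : fun_of (r *m heat_mx) = heat_step (fun_of r).
Proof.
have rE : fun_of r = fun x => \sum_i r 0 i * vertex_fun i x.
  apply/funext => x; rewrite (bigD1 (enum_rank x)) //= /vertex_fun.
  rewrite enum_rankK eqxx mulr1 big1 ?addr0 // => i ix.
  case: eqP => [xi|_]; last by rewrite mulr0.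
  by rewrite xi enum_valK eqxx in ix.
apply/funext => x; rewrite rE heat_step_sum /fun_of mxE.
by apply: eq_bigr => i _; rewrite mxE enum_rankK.
Qed.

Lemma measure_mx_pos r : r != 0 -> 0 < (r *m measure_mx *m r^T) 0 0.
Proof.
move=> r_neq0.
have rE : (r *m measure_mx *m r^T) 0 0 =
    \sum_i measure G (enum_val i) * r 0 i ^+ 2.
  rewrite mxE; apply: eq_bigr => i _.
  by rewrite mul_mx_diag !mxE; ring.
have term_ge0 i : 0 <= measure G (enum_val i) * r 0 i ^+ 2.
  by rewrite mulr_ge0 ?sqr_ge0 ?ltW ?measure_gt0.
rewrite rE lt_def sumr_ge0 // andbT; apply: contra r_neq0.
rewrite psumr_eq0 // => /allP r0; apply/eqP/rowP => i; rewrite mxE.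
have := r0 i (mem_index_enum _).
by rewrite mulf_eq0 gt_eqF ?measure_gt0 //= sqrf_eq0 => /eqP.
Qed.

Lemma heat_mx_selfadjoint : heat_mx *m measure_mx = measure_mx *m heat_mx^T.
Proof.
have innerE u i : inner G u (vertex_fun i) =
    measure G (enum_val i) * u (enum_val i).
  rewrite /inner (bigD1 (enum_val i)) //= /vertex_fun eqxx mulr1.
  by rewrite big1 ?addr0 // => x /negPf ->; rewrite mulr0.
apply/matrixP => i j; rewrite mul_mx_diag mul_diag_mx !mxE.
rewrite mulrC -innerE inner_heat_step -innerE.
by apply: eq_bigr => x _; ring.
Qed.

(** The pairing with all rows of [control_mx B] sees exactly the values on [B],
    since the measure is positive; and [I - H] has the eigenvalue [a] where [H]
    has the eigenvalue [1 - a]. *)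
Lemma heat_mx_eigenvector (B : {set X}) (a : R) r :
  no_eigenfunction_vanishing_on G q B ->
  r *m heat_mx = a *: r -> r *m measure_mx *m (control_mx B)^T = 0 -> r = 0.
Proof.
move=> noeig rA rB; apply: contrapT => r_neq0; apply: noeig.
have stepE : heat_step (fun_of r) = fun x => a * fun_of r x.
  by rewrite -fun_of_heat_mx rA; apply/funext => x; rewrite /fun_of mxE.
exists (fun_of r); split.
- exists (1 - a) => x; have := congr1 (@^~ x) stepE.
  by rewrite /= /heat_step mulrBl mul1r => <-; ring.
- apply: contrapT => allr0; apply: r_neq0; apply/rowP => i; rewrite mxE.
  apply: contrapT => /eqP ri; apply: allr0; exists (enum_val i).
  by rewrite /fun_of enum_valK.
- move=> x xB; have := congr1 (fun s : 'rV_#|X| => s 0 (enum_rank x)) rB.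
  rewrite tr_diag_mx !mul_mx_diag !mxE enum_rankK xB mulr1 => /eqP.
  by rewrite mulf_eq0 [measure G x == 0]gt_eqF ?measure_gt0 // orbF => /eqP.
Qed.

Lemma heat_flow_causal f1 f2 w t :
  (forall x s, (s < t)%N -> f1 x s = f2 x s) ->
  heat_flow G q f1 w t = heat_flow G q f2 w t.
Proof.
elim: t => [//|t IH] f12; apply/funext => x /=.
by rewrite IH ?f12 // => y s st; apply: f12; apply: ltnW.
Qed.

(** A row of [K_T (I - H) + L(B)] is reached by steering to its first component
    before time [T] and applying the second as the source at time [T]. *)
Lemma reach_space_controlled (B : {set X}) T (r : 'rV_#|X|) :
  (r <= reach_space heat_mx (control_mx B) T)%MS ->
  exists f, supported_in B T f /\ heat_flow G q f (fun=> 0) T = fun_of r.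
Proof.
elim: T r => [|T IH] r.
  rewrite submx0 => /eqP ->; exists (fun _ _ => 0); split=> [x t|].
    by rewrite eqxx.
  by apply/funext => x; rewrite /fun_of mxE.
case/sub_addsmxP => -[a b] /= rE.
have [f [suppf flowf]] := IH _ (submxMl a _).
pose last_control := fun_of (b *m control_mx B).
exists (fun x t => if t == T then last_control x else f x t); split.
  move=> x t /=; have [-> h|_ /suppf [xB tT]] := eqVneq t T; last first.
    by split=> //; apply: ltnW.
  split=> //; apply: contra_neqT h => xB.
  by rewrite /last_control /fun_of mul_mx_diag !mxE enum_rankK (negPf xB) mulr0.
apply/funext => x; rewrite eqxx -[X in X + _]/(heat_step _ x).
have -> : heat_flow G q (fun x t => if t == T then last_control x else f x t)
    (fun=> 0) T = fun_of (a *m reach_space heat_mx (control_mx B) T).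
  by rewrite -flowf; apply: heat_flow_causal => y s sT; rewrite ltn_eqF.
by rewrite -fun_of_heat_mx rE mulmxA /last_control /fun_of [RHS]mxE.
Qed.

Lemma reachable_set_full (B : {set X}) T :
  no_eigenfunction_vanishing_on G q B -> (#|X| <= T)%N ->
  reachable_set G q B T = [set: X -> R]%classic.
Proof.
move=> noeig XT; apply/seteqP; split=> // v _.
have full : row_full (reach_space heat_mx (control_mx B) #|X|).
  apply: reach_space_full measure_mx_pos heat_mx_selfadjoint _ => a r.
  exact: heat_mx_eigenvector.
have /reach_space_controlled [f [suppf flowf]] :
    (row_of v <= reach_space heat_mx (control_mx B) T)%MS.
  apply: submx_trans (submx_full _ full) _; exact: reach_space_mono.
exists f, (fun x t => heat_flow G q f (fun=> 0) t x); split=> //.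
  by split=> // x t _; apply: heat_operator_flow.
by rewrite -[RHS]row_ofK -flowf.
Qed.

End Schrodinger.

Theorem theorem1p7 (R : realType) (X : finType) (G : weighted_graph R X)
    (q : X -> R) (B : {set X})
    (hB : no_eigenfunction_vanishing_on G q B) :
  (forall (lambda : 'I_#|X| -> R) (phi : 'I_#|X| -> X -> R),
     spectral_family G q lambda phi ->
   forall (X' : finType) (G' : weighted_graph R X') (q' : X' -> R)
     (B' : {set X'}),
     no_eigenfunction_vanishing_on G' q' B' ->
     #|X'| = #|X| ->
   forall Phi0 : {x : X | x \in B} -> {x' : X' | x' \in B'},
     bijective Phi0 ->
   forall (lambda' : 'I_#|X| -> R) (phi' : 'I_#|X| -> X' -> R),
     spectral_family G' q' lambda' phi' ->
     (forall j, lambda' j = lambda j) ->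
     (forall j (z : {x : X | x \in B}),
        phi' j (val (Phi0 z)) = phi j (val z)) ->
   forall (w : X -> R) (w' : X' -> R)
     (U : X -> nat -> R) (U' : X' -> nat -> R),
     heat_solution G q w U ->
     heat_solution G' q' w' U' ->
     (forall (z : {x : X | x \in B}) (t : nat),
        U (val z) t = U' (val (Phi0 z)) t) ->
   forall j, inner G w (phi j) = inner G' w' (phi' j))
  /\
  (forall T : nat, (0 < T)%N -> (#|X| <= T)%N ->
     reachable_set G q B T = [set: X -> R]%classic).
Proof.
split; last by move=> T _; apply: reachable_set_full.
move=> lambda phi spec X' G' q' B' _ _ Phi0 _ lambda' phi' spec' lambdaE phiE.
move=> w w' U U' solU solU' UE j; apply/eqP; rewrite -subr_eq0; apply/eqP.
pose c k := inner G w (phi k) - inner G' w' (phi' k).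
apply: (exp_sums_separate G q B lambda c phi hB spec) => x xB t.
have := UE (exist _ x xB) t.
rewrite (heat_solution_spectral G q lambda phi w U _ _ spec solU).
rewrite (heat_solution_spectral G' q' lambda' phi' w' U' _ _ spec' solU').
move=> UB; transitivity (
    \sum_k inner G w (phi k) * (1 - lambda k) ^+ t * phi k x
    - \sum_k inner G' w' (phi' k) * (1 - lambda' k) ^+ t
        * phi' k (val (Phi0 (exist _ x xB)))); last by rewrite -UB subrr.
rewrite -sumrB; apply: eq_bigr => k _.
by rewrite phiE lambdaE /= /c; ring.
Qed.
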